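(* Let $0<q<1$ and $k\in\mathbb{N}$, and let $M^1_q(k,N)$ denote the $k$th factorial moment of the Meixner ensemble with parameters $\gamma=1$ and $q$ and with $N$ particles. Suppose that $N-1$ has the $2$-negative binomial distribution $\mu^2_{tq}$, with $0<t<1/q$. Then $$\int_0^1\int_{-1}^1\left(\frac{u(1+q+2\sqrt q\,s)}{1-q}\right)^k\frac{\mathrm{d}s\,\mathrm{d}u}{\pi\sqrt{1-s^2}}=\lim_{t\to1/q}\int\frac{M^1_q(k,m+1)}{(m+2)_k}\,\mathrm{d}\mu^2_{tq}(m),$$ where the limit is taken with $t\in(0,1/q)$.
   Context: Conventions: $\mathbb{N}=\{0,1,2,\dots\}$; an empty product is $1$. Hypergeometric notation: $(a)_i=a(a+1)\cdots(a+i-1)$ and ${}_2F_1\left(\begin{matrix}a,b\\ c\end{matrix};z\right)=\sum_{i\ge0}\frac{(a)_i(b)_i}{(c)_i}\frac{z^i}{i!}$, which terminates if $a$ or $b$ is a nonpositive integer. The geometric reference measure is $\mu_q^1(x)=q^x(1-q)$, $x\in\mathbb{N}$. The normalised Meixner polynomials with $\gamma=1$ are $m_n(x;1,q)=q^{n/2}\;{}_2F_1\left(\begin{matrix}-n,-x\\ 1\end{matrix};1-\frac1q\right)$, $n\in\mathbb{N}$. The Meixner ($\gamma=1$) one-point function with $N\ge1$ particles is the probability mass function on $\mathbb{N}$ given by $\rho^1_{N,q}(x)=\frac1N\sum_{n=0}^{N-1}m_n(x;1,q)^2\mu_q^1(x)$, and the factorial moment is $M^1_q(k,N)=\sum_{x\ge0}x(x-1)\cdots(x-k+1)\,\rho^1_{N,q}(x)$.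 The 2-negative binomial distribution with parameter $tq\in(0,1)$ is $\mu^2_{tq}(m)=(m+1)(tq)^m(1-tq)^2$, $m\in\mathbb{N}$. *)

(* Defs.v *)
(* MathComp-Analysis, over an arbitrary R : realType *)
From HB Require Import structures.
From mathcomp Require Import all_boot all_order all_algebra.
From mathcomp Require Import all_classical all_reals all_analysis.
From mathcomp Require Import ring.

Set Implicit Arguments.
Unset Strict Implicit.
Unset Printing Implicit Defensive.

Import Order.TTheory GRing.Theory Num.Theory.
Import numFieldNormedType.Exports.

Local Open Scope classical_set_scope.
Local Open Scope ring_scope.

Definition pochhammer {R : realType} (a : R) (i : nat) : R :=
  \prod_(j < i) (a + j%:R).

(* A junk value when the series diverges; for a or b a nonpositive integer the
   terms eventually vanish. *)
Definition hyp2F1 {R : realType} (a b c z : R) : R :=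
  limn (series (fun i =>
    pochhammer a i * pochhammer b i / pochhammer c i * (z ^+ i / i`!%:R))).

(* Mass function of the geometric reference measure. *)
Definition mu1 {R : realType} (q : R) (x : nat) : R := q ^+ x * (1 - q).

(* The normalised Meixner polynomials with gamma = 1. *)
Definition meixner {R : realType} (q : R) (n : nat) (x : R) : R :=
  q `^ (n%:R / 2) * hyp2F1 (- n%:R) (- x) 1 (1 - 1 / q).

Definition rho1 {R : realType} (q : R) (N x : nat) : R :=
  N%:R^-1 * \sum_(n < N) meixner q n x%:R ^+ 2 * mu1 q x.

(* The falling factorial x ^_ k in nat is 0 when x < k, in agreement with
   x (x - 1) ... (x - k + 1) over the integers. *)
Definition factorial_moment {R : realType} (q : R) (k N : nat) : \bar R :=
  (\sum_(0 <= x <oo) ((x ^_ k)%:R * rho1 q N x)%:E)%E.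

Definition negbin2_pmf {R : realType} (p : R) (m : nat) : R :=
  m.+1%:R * p ^+ m * (1 - p) ^+ 2.

(* The 2-negative binomial distribution; outside 0 < p < 1 the value is an
   arbitrary probability measure, so that negbin2 is total. *)
Definition negbin2 {R : realType} (p : R) : set nat -> \bar R :=
  fun U => if 0 < p < 1 then (\esum_(m in U) (negbin2_pmf p m)%:E)%E
           else \d_0%N U.

Section negbin2_measure.
Context {R : realType} (p : R).

Lemma negbin2_pmf_ge0 m : 0 < p < 1 -> 0 <= negbin2_pmf p m.
Proof.
move=> /andP[p0 p1].
by rewrite /negbin2_pmf mulr_ge0 ?sqr_ge0// mulr_ge0// exprn_ge0// ltW.
Qed.

Let series_negbin2_pmf n : series (negbin2_pmf p) n =
  1 - p ^+ n - (1 - p) * (n%:R * p ^+ n).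
Proof.
rewrite /series/=; elim: n => [|n IH].
  by rewrite big_geq// expr0 mul0r mulr0 subrr subr0.
rewrite big_nat_recr//= IH /negbin2_pmf (exprS p n) -(natr1 n); ring.
Qed.

Let cvg_series_negbin2_pmf : 0 < p < 1 ->
  series (negbin2_pmf p) n @[n --> \oo] --> (1 : R).
Proof.
move=> p01; have /andP[p0 p1] := p01.
have pmf0 m : 0 <= negbin2_pmf p m by exact: negbin2_pmf_ge0.
have pn : p ^+ n @[n --> \oo] --> (0 : R).
  by apply: cvg_expr; rewrite gtr0_norm.
have pmfn : negbin2_pmf p n @[n --> \oo] --> (0 : R).
  apply: cvg_series_cvg_0; apply: nondecreasing_is_cvgn.
    by apply/nondecreasing_series => // n _ _; exact: pmf0.
  exists 1 => _ [n _ <-]; rewrite series_negbin2_pmf.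
  rewrite -addrA -opprD gerBl addr_ge0// ?exprn_ge0 ?(ltW p0)//.
  by rewrite mulr_ge0 ?subr_ge0 ?(ltW p1)// mulr_ge0// exprn_ge0// ltW.
have npn : n%:R * p ^+ n @[n --> \oo] --> (0 : R).
  have -> : (fun n => n%:R * p ^+ n) =
      (fun n => (1 - p) ^- 2 * negbin2_pmf p n - p ^+ n).
    apply/funext => n; rewrite /negbin2_pmf -(natr1 n); field.
    by rewrite subr_eq0 gt_eqF.
  have -> : (0 : R) = (1 - p) ^- 2 * 0 - 0 by rewrite mulr0 subrr.
  by apply: cvgB => //; apply: cvgM; [exact: cvg_cst|exact: pmfn].
under eq_fun do rewrite series_negbin2_pmf.
have := cvgB (cvgB (cvg_cst (1 : R)) pn) (cvgM (cvg_cst (1 - p)) npn).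
by rewrite mulr0 !subr0; apply.
Qed.

Local Open Scope ereal_scope.

Let negbin2_0 : negbin2 p set0 = 0.
Proof. by rewrite /negbin2 measure0; case: ifPn => //; rewrite esum_set0. Qed.

Let negbin2_ge0 U : 0 <= negbin2 p U.
Proof.
rewrite /negbin2; case: ifPn => // p01; apply: esum_ge0 => /= n Un.
by rewrite lee_fin negbin2_pmf_ge0.
Qed.

Let negbin2_sigma_additive : semi_sigma_additive (negbin2 p).
Proof.
move=> F mF tF mUF; rewrite /negbin2; case: ifPn => p01; last first.
  exact: measure_semi_sigma_additive.
apply: cvg_toP.
  apply: ereal_nondecreasing_is_cvgn => a b ab.
  apply: lee_sum_nneg_natr => // n _ _.
  by apply: esum_ge0 => /= ? _; rewrite lee_fin negbin2_pmf_ge0.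
by rewrite nneseries_sum_bigcup// => i; rewrite lee_fin negbin2_pmf_ge0.
Qed.

HB.instance Definition _ := isMeasure.Build _ _ _ (negbin2 p)
  negbin2_0 negbin2_ge0 negbin2_sigma_additive.

Let negbin2_setT : negbin2 p [set: nat] = 1.
Proof.
rewrite /negbin2; case: ifPn => [p01|_]; last by rewrite probability_setT.
have pmf0 m : (0 <= negbin2_pmf p m)%R by exact: negbin2_pmf_ge0.
rewrite -nneseries_esumT; last by move=> n; rewrite lee_fin.
apply/cvg_lim => //; under eq_fun do rewrite sumEFin.
by apply: cvg_EFin; [near=> n | exact: cvg_series_negbin2_pmf].
Unshelve. all: by end_near. Qed.

HB.instance Definition _ :=
  @Measure_isProbability.Build _ _ R (negbin2 p) negbin2_setT.

End negbin2_measure.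

(* Main.v *)
(* Writing B_k(s, r) for the generating function in (n, m) of
   \sum_y C(y + k, k) q^y Q_n(y) Q_m(y), with Q_n the unnormalised Meixner
   polynomials of parameter gamma = k + 1, shifting the summation index by one
   gives (1 - q) (1 - s r / q) B_k = B_(k - 1), which yields orthogonality
   together with the norms.  Expanding the gamma = 1 polynomials at y + k in the
   Q_n then gives the factorial moments in closed form,
     M(k, N) = (1 - q)^-k / (N (k + 1)) *
               \sum_(j <= k) C(k, j)^2 q^j (N + j) (N + j - 1) ... (N + j - k).
   Hence M(k, m + 1) / (m + 2)_k lies in [L - K / (m + 1), L] where
   L = (1 - q)^-k / (k + 1) * \sum_j C(k, j)^2 q^j, and the integral of
   K / (m + 1) under the 2-negative binomial law of parameter p is K (1 - p),
   which vanishes as p tends to 1.  Finally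
   (1 + q + 2 sqrt q cos phi)^k = |1 + sqrt q e^(i phi)|^(2k) has mean
   \sum_j C(k, j)^2 q^j over [0, pi], so the double integral is L. *)
Require Import Defs.
From mathcomp Require Import all_boot all_order all_algebra.
From mathcomp Require Import all_classical all_reals all_analysis.
From mathcomp Require Import measurable_realfun ring lra zify.
Import Order.TTheory GRing.Theory Num.Theory.
Import numFieldNormedType.Exports.
Local Open Scope classical_set_scope.
Local Open Scope ring_scope.
Set Implicit Arguments.
Unset Strict Implicit.
Unset Printing Implicit Defensive.

(** * Sequences of polynomial growth *)

Section polynomially_bounded.
Variable R : realType.
Implicit Types f g : nat -> R.

(** A summability criterion that survives sums, products and index shifts, so that every
    rearrangement of series below can be justified by structure alone. *)
Definition polybnd f := exists C d, forall x, `|f x| <= C * x.+1%:R ^+ d.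

Lemma polybnd_cst c : polybnd (fun=> c).
Proof. by exists `|c|, 0%N => x; rewrite expr0 mulr1. Qed.

Lemma polybndD f g : polybnd f -> polybnd g -> polybnd (fun x => f x + g x).
Proof.
move=> [C [d fC]] [D [e gD]]; exists (C + D), (d + e)%N => x.
have x1 n m : x.+1%:R ^+ n <= x.+1%:R ^+ (n + m) :> R.
  by rewrite ler_weXn2l ?leq_addr// ler1n.
have C0 : 0 <= C by have := fC 0%N; rewrite expr1n mulr1; exact: le_trans.
have D0 : 0 <= D by have := gD 0%N; rewrite expr1n mulr1; exact: le_trans.
rewrite mulrDl (le_trans (ler_normD _ _))// lerD//.
  by rewrite (le_trans (fC x))// ler_wpM2l.
by rewrite (le_trans (gD x))// ler_wpM2l// addnC.
Qed.

Lemma polybndM f g : polybnd f -> polybnd g -> polybnd (fun x => f x * g x).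
Proof.
move=> [C [d fC]] [D [e gD]]; exists (C * D), (d + e)%N => x.
by rewrite normrM exprD mulrACA ler_pM.
Qed.

Lemma polybnd_sum I (r : seq I) (F : I -> nat -> R) :
  (forall i, polybnd (F i)) -> polybnd (fun x => \sum_(i <- r) F i x).
Proof.
move=> pF; elim: r => [|i r IH].
  by under eq_fun do rewrite big_nil; exact: polybnd_cst.
by under eq_fun do rewrite big_cons; exact: polybndD.
Qed.

Lemma polybnd_shift f : polybnd f -> polybnd (fun x => f x.+1).
Proof.
move=> [C [d fC]]; exists (C * 2 ^+ d), d => x.
have C0 : 0 <= C by have := fC 0%N; rewrite expr1n mulr1; exact: le_trans.
rewrite (le_trans (fC _))// -mulrA ler_wpM2l// -exprMn lerXn2r ?nnegrE//.
by rewrite -natrM ler_nat; lia.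
Qed.

Lemma polybnd_ffact j : polybnd (fun x => (x ^_ j)%:R).
Proof.
exists 1, j => x; rewrite mul1r normr_nat -natrX ler_nat.
elim: j x => [|j IH] [|x]//; rewrite ffactSS expnS leq_mul//.
by rewrite (leq_trans (IH x))//; case: j {IH} => // j; rewrite leq_exp2r.
Qed.

Lemma polybnd_bin j : polybnd (fun x => 'C(x, j)%:R).
Proof.
have -> : (fun x => 'C(x, j)%:R) = (fun x => j`!%:R^-1 * (x ^_ j)%:R) :> (nat -> R).
  apply/funext => x; rewrite -bin_ffact natrM mulrCA mulVf ?mulr1//.
by apply: polybndM; [exact: polybnd_cst|exact: polybnd_ffact].
Qed.

End polynomially_bounded.

(** * Series against the geometric weight q^x *)

Section weighted_sum.
Variables (R : realType) (q : R).
Hypotheses (hq0 : 0 < q) (hq1 : q < 1).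
Implicit Types f g : nat -> R.

Definition wseries f := series (fun x => q ^+ x * f x).
Definition wsum f : R := limn (wseries f).

(** Multiplying by 1 - q telescopes: by Pascal's rule it lowers d by one, up to a boundary term of
    favourable sign. *)
Lemma wseries_bin_le d n : wseries (fun x => 'C(x + d, d)%:R) n <= (1 - q) ^- d.+1.
Proof.
have q1 : 0 < 1 - q by rewrite subr_gt0.
rewrite /wseries; elim: d n => [|d IH] n.
  rewrite expr1 -[leRHS]mul1r ler_pdivlMr//.
  suff -> : series (fun x => q ^+ x * 'C(x + 0, 0)%:R) n * (1 - q) = 1 - q ^+ n.
    by rewrite gerBl exprn_ge0// ltW.
  rewrite /series/=; elim: n => [|n IH]; first by rewrite big_geq// mul0r subrr.
  by rewrite big_nat_recr//= mulrDl IH bin0 mulr1 exprS; ring.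
rewrite exprSr invfM ler_pdivlMr//; apply: le_trans (IH n).
have step m : series (fun x => q ^+ x * 'C(x + d.+1, d.+1)%:R) m * (1 - q) =
   series (fun x => q ^+ x * 'C(x + d, d)%:R) m - q ^+ m * 'C(m + d, d.+1)%:R.
  rewrite /series/=; elim: m => [|m IHm].
    by rewrite !big_geq// mul0r add0n bin_small// mulr0 subrr.
  rewrite !big_nat_recr//= mulrDl {}IHm exprS addSn !addnS !binS !natrD; ring.
by rewrite step gerBl mulr_ge0// exprn_ge0// ltW.
Qed.

Lemma is_cvg_wseries f : polybnd f -> cvgn (wseries f).
Proof.
move=> [C [d fC]].
have C0 : 0 <= C by have := fC 0%N; rewrite expr1n mulr1; exact: le_trans.
apply: normed_cvg.
(* The dominating series comes from (x + 1)^d <= (x + 1) ... (x + d) = d! C(x + d, d). *)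
pose g x := C * d`!%:R * (q ^+ x * 'C(x + d, d)%:R).
apply: (@series_le_cvg _ _ g) => [x|x|x|].
- exact: normr_ge0.
- by rewrite /g !mulr_ge0// exprn_ge0// ltW.
- rewrite /g/= normrM ger0_norm ?exprn_ge0 ?(ltW hq0)//.
  rewrite [leRHS]mulrCA ler_pM2l ?exprn_gt0// (le_trans (fC x))//.
  rewrite -mulrA ler_wpM2l// -natrM -natrX ler_nat mulnC bin_ffact.
  elim: d {fC g} => // d IH; rewrite addnS ffactSS expnS leq_mul//.
  by rewrite ltnS leq_addr.
- apply: (@is_cvg_seriesZ _ (fun x => q ^+ x * 'C(x + d, d)%:R) (C * d`!%:R)).
  apply: nondecreasing_is_cvgn.
    by apply/nondecreasing_series => n _ _; rewrite mulr_ge0// exprn_ge0// ltW.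
  by exists ((1 - q) ^- d.+1) => _ [n _ <-]; exact: wseries_bin_le.
Qed.

Lemma wsumE f v : wseries f @ \oo --> v -> wsum f = v.
Proof. by move=> fv; rewrite /wsum; exact/cvg_lim. Qed.

Lemma wsumD f g : polybnd f -> polybnd g ->
  wsum (fun x => f x + g x) = wsum f + wsum g.
Proof.
move=> /is_cvg_wseries cf /is_cvg_wseries cg.
rewrite /wsum -lim_seriesD//; congr (limn (series _)); apply/funext => x.
by rewrite mulrDr.
Qed.

Lemma wsumZ c f : polybnd f -> wsum (fun x => c * f x) = c * wsum f.
Proof.
move=> /is_cvg_wseries cf.
rewrite /wsum; transitivity (limn (series (c *: (fun x => q ^+ x * f x)))).
  by congr (limn (series _)); apply/funext => x; rewrite mulrCA.
exact: lim_seriesZ.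
Qed.

Lemma wsum0 : wsum (fun=> 0) = 0.
Proof.
apply: wsumE; suff -> : wseries (fun=> 0) = (fun=> 0) by exact: cvg_cst.
by apply/funext => n; rewrite /wseries /series/= big1// => i _; rewrite mulr0.
Qed.

Lemma wsum_sum I (r : seq I) (F : I -> nat -> R) : (forall i, polybnd (F i)) ->
  wsum (fun x => \sum_(i <- r) F i x) = \sum_(i <- r) wsum (F i).
Proof.
move=> pF; elim: r => [|i r IH].
  by rewrite big_nil; under eq_fun do rewrite big_nil; exact: wsum0.
rewrite big_cons -IH -wsumD//; last exact: polybnd_sum.
by congr wsum; apply/funext => x; rewrite big_cons.
Qed.

Lemma wsumS f : polybnd f -> wsum f = f 0%N + q * wsum (fun x => f x.+1).
Proof.
move=> pf; apply: wsumE; rewrite -cvg_shiftS/=.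
have pf1 := polybnd_shift pf.
have -> : (fun n => wseries f n.+1) =
    (fun n => f 0%N + q * wseries (fun x => f x.+1) n).
  apply/funext => n; rewrite /wseries /series/= big_nat_recl// expr0 mul1r.
  rewrite mulr_sumr; congr (_ + _); apply: eq_bigr => i _.
  by rewrite exprS mulrA.
apply: cvgD; first exact: cvg_cst.
by apply: cvgM; [exact: cvg_cst|exact: is_cvg_wseries].
Qed.

End weighted_sum.

(** * Meixner polynomials of integer parameter and their orthogonality *)

Section meixner_sums.
Variables (R : realType) (q : R).
Hypotheses (hq0 : 0 < q) (hq1 : q < 1).

Let w : R := 1 - 1 / q.

(* [mxQ k n.+1] is 'C(n + k, k) times the degree-n Meixner polynomial with
   gamma = k + 1, so that
     \sum_n mxQ k n.+1 y * s ^ n = (1 - s / q) ^ y * (1 - s) ^ (- y - k - 1);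
   the index is shifted so that [mxQ k 0] can be the zero function. *)
Definition mxQ (k n y : nat) : R :=
  if n is n'.+1 then
    \sum_(j < n) 'C(n' + k, k + j)%:R * 'C(y, j)%:R * w ^+ j
  else 0.

Arguments mxQ : simpl never.

Lemma mxQ_widen k n y m : (n < m)%N ->
  mxQ k n.+1 y = \sum_(j < m) 'C(n + k, k + j)%:R * 'C(y, j)%:R * w ^+ j.
Proof.
move=> nm; rewrite /mxQ (big_ord_widen _ (fun j =>
  'C(n + k, k + j)%:R * 'C(y, j)%:R * w ^+ j) nm).
rewrite big_mkcond/=; apply: eq_bigr => j _; case: ifPn => //.
by rewrite -leqNgt => nj; rewrite bin_small ?mul0r// addnC ltn_add2l.
Qed.

(** On generating functions in s, this is multiplication by 1 - s, which lowers the parameter by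
    one. *)
Lemma mxQ_raise k n y : mxQ k.+1 n y - mxQ k.+1 n.-1 y = mxQ k n y.
Proof.
case: n => [|n]; first by rewrite subrr.
case: n => [|n] /=.
  by rewrite /mxQ subr0 !big_ord1 !add0n !addn0 !binn.
rewrite (@mxQ_widen _ n y n.+2)// /mxQ -sumrB; apply: eq_bigr => j _.
rewrite -!mulrBl; congr (_ * _ * _).
by rewrite !addnS !addSn binS natrD; ring.
Qed.

(** The generating function of parameter k at y + 1 is 1 - s / q times that of parameter k + 1 at
    y. *)
Lemma mxQ_shift k n y :
  mxQ k n y.+1 = mxQ k.+1 n y - q^-1 * mxQ k.+1 n.-1 y.
Proof.
case: n => [|n]; first by rewrite mulr0 subrr.
have wE : q^-1 = 1 - w by rewrite /w; lra.
have -> : mxQ k.+1 n.+1 y - q^-1 * mxQ k.+1 n.+1.-1 y =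
    mxQ k n.+1 y + w * mxQ k.+1 n.+1.-1 y.
  by rewrite -(mxQ_raise k n.+1 y) wE; ring.
rewrite [LHS]/mxQ big_ord_recl.
under eq_bigr do rewrite lift0 binS natrD mulrDr mulrDl.
rewrite big_split/= addrA; congr (_ + _).
  by rewrite /mxQ big_ord_recl/= !bin0.
case: n => [|n]; first by rewrite /mxQ big_ord0 mulr0.
rewrite /mxQ mulr_sumr/=; apply: eq_bigr => j _.
by rewrite !addnS !addSn exprS; ring.
Qed.

Lemma polybnd_mxQ k n : polybnd (mxQ k n).
Proof.
case: n => [|n]; first exact: polybnd_cst.
apply: polybnd_sum => j; apply: polybndM; last exact: polybnd_cst.
by apply: polybndM; [exact: polybnd_cst|exact: polybnd_bin].
Qed.

Lemma mxQ00 n : mxQ 0 n.+1 0 = 1.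
Proof.
by rewrite /mxQ big_ord_recl/= !bin0 !mulr1 big1 ?addr0// => j _;
  rewrite bin0n mulr0 mul0r.
Qed.

(** Up to the factor (1 - q)^(k + 1), the inner product for the negative binomial law of parameter k
    + 1. *)
Definition mxQdot (k n m : nat) : R :=
  wsum q (fun y => 'C(y + k, k)%:R * (mxQ k n y * mxQ k m y)).

Lemma polybnd_binD k : polybnd (fun y => 'C(y + k, k)%:R : R).
Proof.
have h i : polybnd (fun y => 'C(y + i, k)%:R : R).
  elim: i => [|i IH]; first by under eq_fun do rewrite addn0; exact: polybnd_bin.
  by under eq_fun do rewrite addnS -addSn; exact: (polybnd_shift IH).
exact: h.
Qed.

(* For the generating function of [mxQdot k] in the two indices, this is
   (1 - q) (1 - s r / q) B_k = B_(k - 1). *)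
Lemma mxQdot_rec k n m :
  (1 - q) * (mxQdot k n m - q^-1 * mxQdot k n.-1 m.-1) =
  if k is k'.+1 then mxQdot k' n m else ((n == 1%N) && (m == 1%N))%:R.
Proof.
pose W y : R := 'C(y + k, k)%:R.
(* In terms of generating functions, [d] is multiplication by 1 - s and [e] by 1 - s / q. *)
pose d n y := mxQ k n y - mxQ k n.-1 y.
pose e n y := mxQ k n y - q^-1 * mxQ k n.-1 y.
have pc c f : polybnd f -> polybnd (fun y => c * f y : R).
  by apply: polybndM; exact: polybnd_cst.
have pQ := polybnd_mxQ k.
have pd i : polybnd (d i).
  rewrite /d; under eq_fun do rewrite -mulN1r.
  by apply: polybndD => //; exact: pc.
have pe i : polybnd (e i).
  rewrite /e; under eq_fun do rewrite -mulNr.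
  by apply: polybndD => //; exact: pc.
have pW : polybnd W by exact: polybnd_binD.
have pWM f g : polybnd f -> polybnd g -> polybnd (fun y => W y * (f y * g y)).
  by move=> pf pg; do 2! apply: polybndM => //.
have dS i y : d i y.+1 = e i y.
  rewrite /d /e !mxQ_shift.
  case: i => [|i] /=; first by rewrite !mulr0 !subrr.
  by rewrite -(mxQ_raise k i.+1) -(mxQ_raise k i)/=; ring.
(* This is the identity (1 - s)(1 - r) - q (1 - s / q)(1 - r / q) = (1 - q)(1 - s r / q). The [d]
   sum is then shifted by one in y, where [dS] turns it into [e]. *)
transitivity (wsum q (fun y => W y * (d n y * d m y)) -
              q * wsum q (fun y => W y * (e n y * e m y))).
  have pQQ n' m' := pWM _ _ (pQ n') (pQ m').
  rewrite -[in RHS]mulNr -[in RHS]wsumZ//; last exact: pWM.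
  rewrite -[in RHS]wsumD//; [|exact: pWM|by apply: pc; exact: pWM].
  rewrite /mxQdot -mulNr -(wsumZ hq0 hq1 (- q^-1))// -wsumD//; last exact: pc.
  rewrite -wsumZ//; last by apply: polybndD => //; exact: pc.
  congr wsum; apply/funext => y; rewrite /d /e /W; field.
  by rewrite lt0r_neq0.
rewrite wsumS//; last exact: pWM.
under eq_fun do rewrite !dS.
rewrite {1}/W add0n binn mul1r.
(* For parameter 0 the weight is constant, so the shifted sums cancel and only the term y = 0
   remains. *)
case: k => [|k] in W d e pQ pd pe pW pWM dS *.
  have -> : (fun y => W y.+1 * (e n y * e m y)) = (fun y => W y * (e n y * e m y)).
    by apply/funext => y; rewrite /W !bin0.
  have d0 i : d i 0%N = (i == 1%N)%:R.
    rewrite /d; case: i => [|[|i]]/=; first by rewrite subrr.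
      by rewrite mxQ00 /mxQ subr0.
    by rewrite !mxQ00 subrr.
  by rewrite addrK !d0 -natrM mulnb.
(* Pascal's rule gives W(y + 1) = W(y) + V(y + 1). The W part cancels; the V part and the term y = 0
   reassemble, by [wsumS] read backwards, into the inner product of parameter k. *)
pose V y : R := 'C(y + k, k)%:R.
have -> : (fun y => W y.+1 * (e n y * e m y)) =
    (fun y => W y * (e n y * e m y) + V y.+1 * (e n y * e m y)).
  apply/funext => y.
  by rewrite /W /V -mulrDl -natrD addSn binS !addnS !addSn.
have pV : polybnd (fun y => V y.+1) by apply: polybnd_shift; exact: polybnd_binD.
rewrite wsumD//; [|exact: pWM|by do 2! apply: polybndM => //].
have cancel (a b x : R) : x + q * (a + b) - q * a = x + q * b by ring.
rewrite cancel.
have dQ i : d i = mxQ k i by apply/funext => y; rewrite /d mxQ_raise.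
rewrite /mxQdot [in RHS]wsumS//; last first.
  by apply: polybndM; [exact: polybnd_binD|apply: polybndM; exact: polybnd_mxQ].
rewrite add0n binn mul1r !dQ; congr (_ + _ * wsum _ _).
by apply/funext => y; rewrite -!dS !dQ.
Qed.

(** The recursion lowers both indices together until one reaches the zero function, so nothing
    survives off the diagonal. On the diagonal, Pascal's rule accumulates the binomial
    coefficient. *)
Lemma mxQdotE k n m :
  mxQdot k n.+1 m.+1 = (n == m)%:R * 'C(n + k, k)%:R * q ^- n / (1 - q) ^+ k.+1.
Proof.
have q0 : q != 0 by rewrite lt0r_neq0.
have q1 : 1 - q != 0 by rewrite lt0r_neq0// subr_gt0.
have Q0 k' i : mxQdot k' 0 i = 0.
  by rewrite /mxQdot; under eq_fun do rewrite mul0r mulr0; exact: wsum0.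
have Q1 k' i : mxQdot k' i 0 = 0.
  by rewrite /mxQdot; under eq_fun do rewrite mulr0 mulr0; exact: wsum0.
have rec k' i j : mxQdot k' i.+1 j.+1 = q^-1 * mxQdot k' i j +
    (if k' is k''.+1 then mxQdot k'' i.+1 j.+1
     else ((i == 0%N) && (j == 0%N))%:R) / (1 - q).
  have /= := mxQdot_rec k' i.+1 j.+1; rewrite !eqSS => <-.
  by field; rewrite q0 q1.
elim: k n m => [|k IHk] n.
  elim: n => [|n IHn] [|m]; rewrite rec ?Q0 ?Q1 ?mulr0 ?add0r/= ?eqSS.
  - by rewrite !bin0 expr0 expr1 invr1 !mulr1.
  - by rewrite !mul0r.
  - by rewrite !mul0r.
  - rewrite IHn !bin0 mul0r addr0 (exprSr q n); field.
    by rewrite q0 q1 expf_neq0.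
elim: n => [|n IHn] [|m]; rewrite rec ?Q0 ?Q1 ?mulr0 ?add0r/= ?eqSS IHk.
- by rewrite eqxx !binn expr0 invr1 !mulr1 !mul1r -invfM -exprSr.
- by rewrite !mul0r.
- by rewrite !mul0r.
- rewrite IHn eqSS; case: (n == m); last by rewrite !mul0r mulr0 addr0.
  have -> : 'C(n.+1 + k.+1, k.+1)%:R = 'C(n + k.+1, k.+1)%:R + 'C(n.+1 + k, k)%:R :> R.
    by rewrite addSn binS natrD addSnnS.
  rewrite !mul1r.
  rewrite (exprS q n) (exprS (1 - q) k.+1); field.
  by rewrite q0 q1 !expf_neq0.
Qed.

(** Iterating [mxQ_shift] multiplies the generating function by (1 - s / q)^k. Truncated subtraction
    is harmless, as [mxQ k 0] is zero. *)
Lemma mxQ_shiftn k n y :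
  mxQ 0 n (y + k) = \sum_(j < k.+1) 'C(k, j)%:R * (- q^-1) ^+ j * mxQ k (n - j) y.
Proof.
elim: k y => [|k IH] y.
  by rewrite big_ord1 bin0 expr0 !mul1r subn0 addn0.
rewrite addnS -addSn IH.
under eq_bigr do rewrite mxQ_shift mulrBr.
rewrite sumrB big_ord_recl [in RHS]big_ord_recl !bin0 -addrA; congr (_ + _).
under [in RHS]eq_bigr do rewrite lift0 binS natrD 2!mulrDl.
rewrite big_split/= [X in _ = X + _]big_ord_recr/= bin_small// !mul0r addr0;
  congr (_ + _).
rewrite -sumrN; apply: eq_bigr => j _.
by rewrite exprS -subnS; ring.
Qed.

End meixner_sums.

(** * Closed form of the factorial moments, and their bounds after scaling *)

Section meixner_moments.
Variables (R : realType) (q : R).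
Hypotheses (hq0 : 0 < q) (hq1 : q < 1).

Lemma pochhammerN n i : pochhammer (- n%:R : R) i = (-1) ^+ i * (n ^_ i)%:R.
Proof.
rewrite /pochhammer; elim: i => [|i IH]; first by rewrite big_ord0 mulr1.
rewrite big_ord_recr/= IH ffactnSr natrM exprS.
have [ni|ni] := leqP i n; last by rewrite ffact_small// !(mul0r, mulr0).
by rewrite natrB//; ring.
Qed.

Lemma pochhammer1 i : pochhammer (1 : R) i = i`!%:R.
Proof.
rewrite /pochhammer; elim: i => [|i IH]; first by rewrite big_ord0.
by rewrite big_ord_recr/= IH factS natrM nat1r mulrC.
Qed.

Lemma pochhammer_ffact m k :
  m.+1%:R * pochhammer (m.+2%:R : R) k = ((m.+1 + k) ^_ k.+1)%:R.
Proof.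
rewrite /pochhammer; elim: k => [|k IH].
  by rewrite big_ord0 mulr1 addn0 ffactn1.
by rewrite big_ord_recr/= mulrA IH [in RHS]addnS ffactSS natrM mulrC -natrD.
Qed.

Lemma hyp2F1_terminating n x (z : R) :
  hyp2F1 (- n%:R) (- x%:R) 1 z = \sum_(j < n.+1) 'C(n, j)%:R * 'C(x, j)%:R * z ^+ j.
Proof.
rewrite /hyp2F1; set f := (fun i => _).
have fE i : f i = 'C(n, i)%:R * 'C(x, i)%:R * z ^+ i.
  rewrite /f !pochhammerN pochhammer1 -!bin_ffact !natrM.
  have : (-1) ^+ i * (-1) ^+ i = 1 :> R by rewrite -exprMn mulrNN mulr1 expr1n.
  move: ((-1) ^+ i) => s ss.
  have i0 : i`!%:R != 0 :> R by rewrite pnatr_eq0 -lt0n fact_gt0.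
  transitivity (s * s * ('C(n, i)%:R * 'C(x, i)%:R * z ^+ i) : R);
    last by rewrite ss mul1r.
  by field.
(* The partial sums are constant from n + 1 on, because 'C(n, i) vanishes for i > n. *)
apply/cvg_lim => //; apply: cvg_near_cst; near=> m.
rewrite /series/= (@big_cat_nat _ _ _ n.+1)//=; last by near: m;
  exact: nbhs_infty_ge.
have -> : \sum_(n.+1 <= i < m) f i = 0.
  by rewrite big_nat big1// => i /andP[ni _]; rewrite fE bin_small// !mul0r.
rewrite addr0; rewrite big_mkord; apply: eq_bigr => i _; rewrite fE.
Unshelve. all: by end_near. Qed.

Lemma sqr_meixner n x :
  meixner q n x%:R ^+ 2 = q ^+ n * mxQ q 0 n.+1 x ^+ 2.
Proof.
rewrite /meixner exprMn hyp2F1_terminating; congr (_ * _ ^+ 2).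
  by rewrite -[LHS]powR_mulrn ?powR_ge0// -powRrM divfK ?pnatr_eq0// powR_mulrn// ltW.
by rewrite /mxQ; apply: eq_bigr => j _; rewrite addn0 add0n.
Qed.

Lemma wsum_shiftn (f : nat -> R) k : polybnd f ->
  (forall x, (x < k)%N -> f x = 0) ->
  wsum q f = q ^+ k * wsum q (fun y => f (y + k)%N).
Proof.
elim: k f => [|k IH] f pf f0.
  by rewrite mul1r; under [in RHS]eq_fun do rewrite addn0.
rewrite wsumS// f0// add0r IH; last 2 first.
- exact: polybnd_shift.
- by move=> x xk; rewrite f0.
by rewrite mulrA -exprS; under [in RHS]eq_fun do rewrite addnS.
Qed.

(** The factor [x ^_ k] kills x < k, and at x = y + k it equals k! C(y + k, k), the weight of
    parameter k + 1. Expanding by [mxQ_shiftn] then leaves only diagonal inner products. *)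
Lemma meixner_moment_term k n :
  (1 - q) * q ^+ n * wsum q (fun x => (x ^_ k)%:R * mxQ q 0 n.+1 x ^+ 2) =
  (1 - q) ^- k * \sum_(j < k.+1) 'C(k, j)%:R ^+ 2 * q ^+ j * ((n + j) ^_ k)%:R.
Proof.
have q0 : q != 0 by rewrite lt0r_neq0.
have q1 : 1 - q != 0 by rewrite lt0r_neq0// subr_gt0.
have pc c f : polybnd f -> polybnd (fun y => c * f y : R).
  by apply: polybndM; exact: polybnd_cst.
rewrite (@wsum_shiftn _ k); last 2 first.
- apply: polybndM; first exact: polybnd_ffact.
  by under eq_fun do rewrite expr2; apply: polybndM; exact: polybnd_mxQ.
- by move=> x xk; rewrite ffact_small// mul0r.
pose a j : R := 'C(k, j)%:R * (- q^-1) ^+ j.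
have pQQ i j : polybnd (fun y =>
    'C(y + k, k)%:R * (mxQ q k (n.+1 - i) y * mxQ q k (n.+1 - j) y)).
  by apply: polybndM; [exact: polybnd_binD|apply: polybndM; exact: polybnd_mxQ].
have -> : (fun y => ((y + k) ^_ k)%:R * mxQ q 0 n.+1 (y + k) ^+ 2) =
    (fun y => \sum_(i < k.+1) \sum_(j < k.+1) k`!%:R * a i * a j *
      ('C(y + k, k)%:R * (mxQ q k (n.+1 - i) y * mxQ q k (n.+1 - j) y))).
  apply/funext => y;
    rewrite mxQ_shiftn// -bin_ffact natrM expr2 mulr_suml mulr_sumr.
  apply: eq_bigr => i _; rewrite !mulr_sumr; apply: eq_bigr => j _.
  by rewrite /a; ring.
rewrite wsum_sum//; last by move=> i; apply: polybnd_sum => j; exact: pc.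
have dotE i j : mxQdot q k (n.+1 - i) (n.+1 - j) = ((i == j) && (i <= n)%N)%:R *
    ('C(n - i + k, k)%:R * q ^- (n - i) / (1 - q) ^+ k.+1).
  have Q0 m : mxQdot q k 0 m = 0.
    by rewrite /mxQdot; under eq_fun do rewrite mul0r mulr0; exact: wsum0.
  have Q1 m : mxQdot q k m 0 = 0.
    by rewrite /mxQdot; under eq_fun do rewrite mulr0 mulr0; exact: wsum0.
  have [ni|ni] := leqP i n; last first.
    have -> : (n.+1 - i = 0)%N by lia.
    by rewrite Q0 andbF mul0r.
  have [nj|nj] := leqP j n; last first.
    have -> : (n.+1 - j = 0)%N by lia.
    have -> : (i == j) = false by rewrite ltn_eqF// (leq_ltn_trans ni).
    by rewrite Q1 mul0r.
  rewrite !subSn// mxQdotE// andbT -!mulrA; congr (_%:R * _).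
  by apply/eqP/eqP; lia.
under eq_bigr => i _.
  rewrite wsum_sum//; last by move=> j; exact: pc.
  under eq_bigr => j _ do rewrite wsumZ// -/(mxQdot q k (n.+1 - i) (n.+1 - j)) dotE.
  rewrite (bigD1 i)//= eqxx big1 ?addr0; last first.
    by move=> j ji; rewrite eq_sym (inj_eq val_inj) (negbTE ji) mul0r mulr0.
  over.
(* The diagonal term i carries q^(k - i), so it matches the summand j = k - i. *)
rewrite [in RHS](reindex_inj rev_ord_inj)/= !mulr_sumr.
apply: eq_bigr => -[i/= ik] _; rewrite subSS.
have ik' : (i <= k)%N by [].
(* For i > n both sides vanish, since then n + (k - i) < k. *)
have -> : ((n + (k - i)) ^_ k = (i <= n) * (k`! * 'C(n - i + k, k)))%N.
  have [ni|ni] := leqP i n; last by rewrite ffact_small//; lia.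
  by rewrite mul1n mulnC bin_ffact; congr (_ ^_ _)%N; lia.
rewrite bin_sub// !natrM; have [ni|ni] := leqP i n;
  last by rewrite !(mul0r, mulr0).
rewrite /a exprNn.
have -> : q ^+ n = q ^+ i * q ^+ (n - i) by rewrite -exprD subnKC.
have -> : q ^+ k = q ^+ i * q ^+ (k - i) by rewrite -exprD subnKC.
rewrite exprVn (exprS (1 - q) k).
have ss : (-1) ^+ i * (-1) ^+ i = 1 :> R by rewrite -exprMn mulrNN mulr1 expr1n.
move: ((-1) ^+ i) ss => s ss.
transitivity (s * s * ((1 - q) ^- k * ('C(k, i)%:R ^+ 2 * q ^+ (k - i) *
  (true%:R * (k`!%:R * 'C(n - i + k, k)%:R))))); last by rewrite ss mul1r.
by field; rewrite q1 !expf_neq0.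
Qed.

Lemma ffactSD x k : (x.+1 ^_ k.+1 = x ^_ k.+1 + k.+1 * x ^_ k)%N.
Proof.
have [kx|xk] := leqP k x; last by rewrite !ffact_small ?muln0//; lia.
by rewrite ffactSS ffactnSr [X in (_ = X + _)%N]mulnC -mulnDl; congr (_ * _)%N;
  lia.
Qed.

(** Telescoping with [ffactSD]; j <= k makes the initial value [j ^_ k.+1] zero. *)
Lemma sum_ffactD N j k : (j <= k)%N ->
  (k.+1 * \sum_(n < N) (n + j) ^_ k = (N + j) ^_ k.+1)%N.
Proof.
move=> jk; elim: N => [|N IH]; first by rewrite big_ord0 muln0 ffact_small.
by rewrite big_ord_recr/= mulnDr IH addSn ffactSD.
Qed.

Lemma factorial_momentE k N : factorial_moment q k N =
  (N%:R^-1 * ((1 - q) ^- k / k.+1%:R) *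
    \sum_(j < k.+1) 'C(k, j)%:R ^+ 2 * q ^+ j * ((N + j) ^_ k.+1)%:R)%:E.
Proof.
pose f n x : R := (1 - q) * q ^+ n * ((x ^_ k)%:R * mxQ q 0 n.+1 x ^+ 2).
have pf n : polybnd (f n).
  apply: polybndM; first exact: polybnd_cst.
  apply: polybndM; first exact: polybnd_ffact.
  by under eq_fun do rewrite expr2; apply: polybndM; exact: polybnd_mxQ.
pose g x : R := N%:R^-1 * \sum_(n < N) f n x.
have pg : polybnd g.
  by apply: polybndM; [exact: polybnd_cst|exact: polybnd_sum].
transitivity (wsum q g)%:E.
  rewrite /factorial_moment; apply/cvg_lim => //.
  under eq_fun do rewrite sumEFin.
  apply: cvg_EFin; first exact: nearW.
  rewrite (_ : _ \o _ = wseries q g); first exact: is_cvg_wseries.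
  apply/funext => m; apply: eq_bigr => x _.
  rewrite /rho1 /g /f mulrCA [RHS]mulrCA; congr (_ * _).
  rewrite !mulr_sumr; apply: eq_bigr => n _.
  by rewrite sqr_meixner /mu1; ring.
congr EFin; rewrite /g wsumZ//; last exact: polybnd_sum.
rewrite wsum_sum// -!mulrA; congr (_ * _).
rewrite /f; under eq_bigr => n _.
  rewrite wsumZ//; last first.
    apply: polybndM; first exact: polybnd_ffact.
    by under eq_fun do rewrite expr2; apply: polybndM; exact: polybnd_mxQ.
  rewrite meixner_moment_term.
  over.
(* With j outermost, the sum over the degree n telescopes by [sum_ffactD]. *)
rewrite -mulr_sumr exchange_big/=; congr (_ * _).
rewrite mulr_sumr; apply: eq_bigr => j _.
rewrite -mulr_sumr mulrCA; congr (_ * _).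
rewrite -(@sum_ffactD N j k); last by rewrite -ltnS.
by rewrite natrM mulKf ?pnatr_eq0// natr_sum.
Qed.

(* (1 - q)^-k / (k + 1) times the k-th moment of 1 + q + 2 sqrt q s under the
   arcsine law *)
Definition limit_moment k : R :=
  (1 - q) ^- k / k.+1%:R * \sum_(j < k.+1) 'C(k, j)%:R ^+ 2 * q ^+ j.

(** A discrete mean value inequality: each of the d increments given by [ffactSD] is at most the
    last one. *)
Lemma ffactD_le x d k : ((x + d) ^_ k.+1 <= x ^_ k.+1 + d * (k.+1 * (x + d).-1 ^_ k))%N.
Proof.
elim: d => [|d IH]; first by rewrite addn0 mul0n addn0.
rewrite addnS/= ffactSD [(d.+1 * _)%N]mulSn addnCA addnC leq_add2l (leq_trans IH)//.
rewrite leq_add2l !leq_mul// -!bin_ffact leq_mul2r leq_bin2l ?orbT//.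
exact: leq_pred.
Qed.

Lemma scaled_moment_bounds k m :
  limit_moment k - limit_moment k * (k * k.+1)%:R / m.+1%:R <=
  fine (factorial_moment q k m.+1) / pochhammer m.+2%:R k <= limit_moment k.
Proof.
have c0 : 0 <= (1 - q) ^- k / k.+1%:R.
  by rewrite divr_ge0// invr_ge0 exprn_ge0// subr_ge0 ltW.
have u0 j : 0 <= 'C(k, j)%:R ^+ 2 * q ^+ j by rewrite mulr_ge0// exprn_ge0// ltW.
have F0 : (0 < (m.+1 + k) ^_ k.+1)%N by rewrite ffact_gt0; lia.
have -> : fine (factorial_moment q k m.+1) / pochhammer m.+2%:R k =
    (1 - q) ^- k / k.+1%:R * \sum_(j < k.+1) 'C(k, j)%:R ^+ 2 * q ^+ j *
      (((m.+1 + j) ^_ k.+1)%:R / ((m.+1 + k) ^_ k.+1)%:R).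
  rewrite factorial_momentE/= -pochhammer_ffact invfM.
  under [in RHS]eq_bigr do rewrite mulrA.
  rewrite -mulr_suml.
  by move: (\sum_(_ < _) _) (_ / _) => S c; ring.
(* With P = [(m.+1 + k).-1 ^_ k], the denominator is (m + 1 + k) P, and by [ffactD_le] the numerator
   falls short of it by at most (k - j)(k + 1) P. *)
have ratio j : (j <= k)%N -> (1 : R) - (k * k.+1)%:R / m.+1%:R <=
    (((m.+1 + j) ^_ k.+1)%:R / ((m.+1 + k) ^_ k.+1)%:R : R) <= 1.
  move=> jk; apply/andP; split; last first.
    rewrite ler_pdivrMr ?ltr0n// mul1r ler_nat.
    by rewrite -!bin_ffact leq_mul2r leq_bin2l ?orbT// leq_add2l.
  rewrite ler_pdivlMr ?ltr0n// -(@ler_pM2l _ m.+1%:R)// mulrA mulrBr mulr1.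
  rewrite [_ * (_ / _)]mulrC divfK// mulrBl lerBlDr -!natrM -natrD ler_nat.
  have := ffactD_le (m.+1 + j) (k - j) k.
  have -> : (m.+1 + j + (k - j) = m.+1 + k)%N by lia.
  have := ffactnS (m.+1 + k) k.
  move: ((m.+1 + k) ^_ k.+1)%N ((m.+1 + j) ^_ k.+1)%N ((m.+1 + k).-1 ^_ k)%N.
  move=> B A P BE BA.
  rewrite (@leq_trans (m.+1 * (A + (k - j) * (k.+1 * P))))%N ?leq_mul2l ?BA ?orbT//.
  rewrite mulnDr leq_add2l BE -mulnA mulnCA leq_mul ?leq_subr//.
  by rewrite mulnCA leq_mul// leq_mul// leq_addr.
rewrite /limit_moment; set S := \sum_(_ < _) _; set T := \sum_(_ < _) _.
have TS : T <= S.
  apply: ler_sum => j _; rewrite ler_piMr ?u0//.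
  by have /andP[] := ratio j (leq_ord j).
have ST : S * (1 - (k * k.+1)%:R / m.+1%:R) <= T.
  rewrite mulr_suml; apply: ler_sum => j _; rewrite ler_wpM2l ?u0//.
  by have /andP[] := ratio j (leq_ord j).
move: ((1 - q) ^- k / k.+1%:R) c0 => C c0.
have -> : C * S - C * S * (k * k.+1)%:R / m.+1%:R =
    C * (S * (1 - (k * k.+1)%:R / m.+1%:R)) by ring.
by apply/andP; split; rewrite ler_wpM2l.
Qed.

End meixner_moments.

(** * Integration against the arcsine weight *)

Section arcsine.
Variable R : realType.

Lemma sum_bin_pascal k (u : nat -> R) :
  \sum_(i < k.+2) 'C(k.+1, i)%:R * u i =
  \sum_(i < k.+1) 'C(k, i)%:R * u i + \sum_(i < k.+1) 'C(k, i)%:R * u i.+1.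
Proof.
rewrite big_ord_recl bin0; under eq_bigr do rewrite lift0 binS natrD mulrDl.
rewrite big_split/= addrA; congr (_ + _).
rewrite [in LHS]big_ord_recr/= bin_small// mul0r addr0 [in RHS]big_ord_recl bin0.
by under [in RHS]eq_bigr do rewrite lift0.
Qed.

(* This is |1 + r e^(i phi)|^(2k), where (1 + r e^(i phi))^k = X + i Y is
   expanded by the binomial theorem. *)
Lemma cos_binomial_expansion k (r phi : R) :
  (1 + r ^+ 2 + 2 * r * cos phi) ^+ k =
  \sum_(i < k.+1) \sum_(j < k.+1) 'C(k, i)%:R * 'C(k, j)%:R * r ^+ (i + j) *
    cos ((i%:R - j%:R) * phi).
Proof.
pose X k := \sum_(i < k.+1) 'C(k, i)%:R * (r ^+ i * cos (i%:R * phi)).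
pose Y k := \sum_(i < k.+1) 'C(k, i)%:R * (r ^+ i * sin (i%:R * phi)).
transitivity (X k ^+ 2 + Y k ^+ 2); last first.
  rewrite !expr2 !mulr_suml -big_split/=; apply: eq_bigr => i _.
  rewrite !mulr_sumr -big_split/=; apply: eq_bigr => j _.
  by rewrite mulrBl cosB exprD; ring.
elim: k => [|k IH].
  by rewrite /X /Y !big_ord1 !mul0r cos0 sin0 !bin0; ring.
(* [XS] and [YS] are the real and imaginary parts of multiplication by 1 + r e^(i phi). *)
have XS : X k.+1 = X k + r * (cos phi * X k - sin phi * Y k).
  rewrite [LHS](sum_bin_pascal k (fun i => r ^+ i * cos (i%:R * phi)));
    congr (_ + _).
  rewrite !mulr_sumr -sumrB mulr_sumr; apply: eq_bigr => i _.
  by rewrite -natr1 mulrDl mul1r cosD exprS; ring.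
have YS : Y k.+1 = Y k + r * (sin phi * X k + cos phi * Y k).
  rewrite [LHS](sum_bin_pascal k (fun i => r ^+ i * sin (i%:R * phi)));
    congr (_ + _).
  rewrite !mulr_sumr -big_split/= mulr_sumr; apply: eq_bigr => i _.
  by rewrite -natr1 mulrDl mul1r sinD exprS; ring.
have c2 : cos phi ^+ 2 = 1 - sin phi ^+ 2 by rewrite -(cos2Dsin2 phi) addrK.
by rewrite exprS IH XS YS; ring: c2.
Qed.

(** The substitution s = cos phi. The weight blows up at both endpoints, so the fundamental theorem
    is applied on compact intervals exhausting ]-1, 1[, and nonnegativity of h allows passage to the
    limit by monotone convergence. *)
Lemma integral_arcsine_weight (h G : R -> R) : continuous h ->
  (forall s : R, -1 < s < 1 -> 0 <= h s) ->
  (forall phi : R, is_derive phi 1 G (h (cos phi))) ->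
  (\int[lebesgue_measure]_(s in `](-1)%R, 1%R[)
    (h s / Num.sqrt (1 - s ^+ 2))%:E = (G pi - G 0)%:E)%E.
Proof.
move=> ch h0 dG.
pose f s := h s / Num.sqrt (1 - s ^+ 2).
pose F s := - G (acos s).
have sq0 (s : R) : -1 < s < 1 -> 0 < 1 - s ^+ 2 by move=> /andP[? ?]; nra.
have cf (s : R) : -1 < s < 1 -> {for s, continuous f}.
  move=> s1; apply: cvgM; first exact: ch.
  apply: cvgV; first by rewrite gt_eqF// sqrtr_gt0 sq0.
  apply: continuous_cvg; first exact: sqrt_continuous.
  by apply: cvgB; [exact: cvg_cst|exact: exprn_continuous].
have dF (s : R) : -1 < s < 1 -> is_derive s 1 F (f s).
  move=> s1; have := is_derive1_acos s1 => da.
  have := is_deriveN (is_derive1_comp (dG (acos s)) da).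
  rewrite acosK ?in_itv/=; last by case/andP: s1 => /ltW -> /ltW ->.
  by rewrite mulrN opprK.
(* Angles decreasing to 0 and staying below 1 <= pi / 2, so that their cosines are positive and
   increase to 1. *)
pose th n : R := n.+2%:R^-1.
have th01 n : 0 < th n < 1 by rewrite invr_gt0 ltr0n/= invf_lt1 ?ltr1n ?ltr0n.
have pi1 := pihalf_ge1 R.
have th_pi n : th n \in `[0, pi].
  have /andP[t0 t1] := th01 n; rewrite in_itv/= (ltW t0)/=.
  by rewrite (le_trans (ltW t1))//; lra.
pose c n := cos (th n).
have c0 n : 0 < c n.
  by apply: cos_gt0_pihalf; have /andP[t0 t1] := th01 n; apply/andP; split; lra.
have c1 n : c n < 1.
  have /andP[t0 t1] := th01 n.
  rewrite -cos0 ltr_cos// in_itv/= lexx/=; lra.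
have thcvg : th n @[n --> \oo] --> (0 : R).
  have := @cvg_harmonic R; rewrite -cvg_shiftS; exact.
have G_continuous : continuous G.
  by move=> x; apply/differentiable_continuous/derivable1_diffP.
pose A n := `[- c n, c n]%classic.
have A1 n (s : R) : A n s -> -1 < s < 1.
  rewrite /A/= in_itv/= => /andP[ns sn].
  by have := c1 n; have := c0 n; move=> ? ?; apply/andP; split; lra.
have AU : \bigcup_n A n = `](-1), 1[%classic.
  apply/seteqP; split => s; first by move=> [n _] /A1; rewrite /= in_itv.
  rewrite /= in_itv/= => /andP[s1 s1'].
  have ccvg : c n @[n --> \oo] --> (1 : R).
    by rewrite -cos0; apply: continuous_cvg => //; exact: continuous_cos.
  have s_lt1 : `|s| < 1 by rewrite ltr_norml s1.
  have [n _ /(_ n (leqnn n))/= sn] := cvgr_gt _ ccvg _ s_lt1.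
  by exists n => //; rewrite /A/= in_itv/= -ler_norml ltW.
have cfA n : {within A n, continuous f}.
  by apply: continuous_in_subspaceT => s; rewrite inE => /A1; exact: cf.
have f0 n s : A n s -> (0 <= (f s)%:E)%E.
  by move=> /A1 s1; rewrite lee_fin divr_ge0 ?sqrtr_ge0 ?h0.
(* The boolean selects one of the two endpoints. *)
have cA n (b : bool) : A n (if b then - c n else c n).
  by have := c0 n; case: b; rewrite /A/= in_itv/= => ?; apply/andP; split; lra.
have intA n : (\int[lebesgue_measure]_(s in A n) (f s)%:E =
    (G (pi - th n) - G (th n))%:E)%E.
  rewrite /A (@continuous_FTC2 _ f F).
  - rewrite /F /c cosK// acosN ?cosK//; last by rewrite cos_geN1 cos_le1.
    by rewrite -EFinB opprK addrC.
  - have := c0 n; lra.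
  - exact: cfA.
  - split.
    + by move=> s /subset_itv_oo_cc /A1 /dF[].
    + apply: cvg_at_right_filter; have /A1/dF[+ _] := cA n true.
      by move/derivable1_diffP/differentiable_continuous.
    + apply: cvg_at_left_filter; have /A1/dF[+ _] := cA n false.
      by move/derivable1_diffP/differentiable_continuous.
  - by move=> s /subset_itv_oo_cc /A1 /dF[_ <-]; rewrite derive1E.
have -> : (G pi - G 0)%:E = limn (fun n => (G (pi - th n) - G (th n))%:E).
  apply/esym/cvg_lim => //; apply: cvg_EFin; first exact: nearW.
  apply: cvgB; last by apply: continuous_cvg => //; exact: G_continuous.
  apply: continuous_cvg; first exact: G_continuous.
  rewrite -[X in _ --> X]subr0.
  by apply: cvgB => //; exact: cvg_cst.
apply/esym/cvg_lim => //.
under eq_fun do rewrite -intA.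
rewrite -AU; apply: ge0_nondecreasing_set_cvg_integral => //.
- apply/nondecreasing_seqP => n; rewrite subsetEset => s;
  rewrite /A/= !in_itv/= => /andP[ns sn].
  have cn : c n <= c n.+1.
    by rewrite /c ltW// ltr_cos// /th ltf_pV2 ?posrE ?ltr0n// ltr_nat.
  by apply/andP; split; lra.
- by move=> n; exact: measurable_itv.
- move=> n; apply/measurable_EFinP.
  exact: (subspace_continuous_measurable_fun (measurable_itv _) (cfA n)).
Qed.

End arcsine.

(** * Moments under the arcsine law, and the integral in u *)

Section arcsine_moment.
Variable R : realType.

Lemma sin_natmul_pi n : sin (n%:R * pi) = 0 :> R.
Proof.
elim: n => [|n IH]; first by rewrite mul0r sin0.
by rewrite -natr1 mulrDl mul1r sinDpi IH oppr0.
Qed.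

Let scaleE (x y : R) : x *: y = x * y. Proof. by []. Qed.

(** The double sum of [cos_binomial_expansion] is integrated term by term over [0, pi]: frequency i
    - j = 0 contributes pi, and every other frequency contributes 0. *)
Lemma integral_arcsine_moment (q c : R) k : 0 <= q -> 0 <= c ->
  (\int[lebesgue_measure]_(s in `](-1)%R, 1%R[)
     ((c * (1 + q + 2 * Num.sqrt q * s)) ^+ k / (pi * Num.sqrt (1 - s ^+ 2)))%:E =
   (c ^+ k * \sum_(j < k.+1) 'C(k, j)%:R ^+ 2 * q ^+ j)%:E)%E.
Proof.
move=> q0 c0; set r := Num.sqrt q.
have r2 : r ^+ 2 = q by rewrite sqr_sqrtr.
pose h s := (c * (1 + q + 2 * r * s)) ^+ k / pi.
pose a (i j : nat) : R := c ^+ k / pi * ('C(k, i)%:R * 'C(k, j)%:R * r ^+ (i + j)).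
pose d (i j : nat) : R := i%:R - j%:R.
pose g i j : R -> R :=
  if i == j then id else (d i j)^-1 \*: (sin \o ((d i j) \*: id)).
have dg i j (phi : R) : is_derive phi 1 (g i j) (cos (d i j * phi)).
  rewrite /g; case: eqVneq => [->|ij].
    by rewrite /d subrr mul0r cos0; exact: is_derive_id.
  have d0 : d i j != 0 by rewrite subr_eq0 eqr_nat.
  apply: is_derive_eq.
  by rewrite !scaleE/= mulr1 mulrCA mulVf// mulr1.
pose G := \sum_(i < k.+1) \sum_(j < k.+1) (a i j) \*: (g i j).
have dG (phi : R) : is_derive phi 1 G (h (cos phi)).
  apply: is_derive_eq.
  rewrite /h exprMn -{1}r2 cos_binomial_expansion mulrAC mulr_sumr;
    apply: eq_bigr => i _.
  by rewrite mulr_sumr; apply: eq_bigr => j _; rewrite /a scaleE !mulrA.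
under eq_integral do rewrite invfM mulrA -/(h _).
rewrite (@integral_arcsine_weight _ h G)//.
- congr EFin; rewrite /G !fct_sumE -sumrB mulr_sumr; apply: eq_bigr => i _.
  rewrite !fct_sumE -sumrB (bigD1 i)//= big1 ?addr0 => [|j ji].
    rewrite /g eqxx /= !scaleE mulr0 subr0 /a exprD -r2 exprAC.
    have : pi != 0 :> R by rewrite lt0r_neq0// pi_gt0.
    by move: (pi : R) => p p0; field.
  have ij : (i == j :> nat) = false by rewrite eq_sym (inj_eq val_inj) (negbTE ji).
  rewrite /g ij /= !scaleE mulr0 sin0 !mulr0 subr0.
  by rewrite /d mulrBl sinB !sin_natmul_pi mul0r mulr0 subrr !mulr0.
- move=> s; apply: cvgM; last exact: cvg_cst.
  apply: (@continuous_cvg _ _ _ _ _ _ (fun x : R => x ^+ k));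
    first exact: exprn_continuous.
  apply: cvgM; first exact: cvg_cst.
  apply: cvgD; first exact: cvg_cst.
  by apply: cvgM; [exact: cvg_cst|exact: cvg_id].
- move=> s /andP[s1 _]; rewrite divr_ge0 ?pi_ge0// exprn_ge0// mulr_ge0//.
  have r0 : 0 <= r by exact: sqrtr_ge0.
  rewrite -r2 (_ : _ + _ = (1 - r) ^+ 2 + 2 * (r * (s + 1))); last by ring.
  by rewrite addr_ge0 ?sqr_ge0// mulr_ge0// mulr_ge0//; lra.
Qed.

Lemma integral_exprn (c : R) k :
  (\int[lebesgue_measure]_(u in `[0%R, 1%R]) (u ^+ k * c)%:E = (c / k.+1%:R)%:E)%E.
Proof.
pose F : R -> R := (c / k.+1%:R) \*: (id ^+ k.+1).
have dF (u : R) : is_derive u 1 F (u ^+ k * c).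
  apply: is_derive_eq; rewrite !scaleE/= mulr1.
  by field; rewrite addrC natr1 pnatr_eq0.
rewrite (@continuous_FTC2 _ _ F)//.
- by congr EFin; rewrite /F /= !fctE !scaleE expr1n expr0n mulr0 subr0 mulr1.
- apply: continuous_subspaceT => u; apply: cvgM; last exact: cvg_cst.
  exact: exprn_continuous.
- have cF : continuous F.
    by move=> u; apply/differentiable_continuous/derivable1_diffP.
  split; first by move=> u _; have [] := dF u.
  + by apply: cvg_at_right_filter; exact: cF.
  + by apply: cvg_at_left_filter; exact: cF.
- by move=> u _; rewrite derive1E; have [_] := dF u.
Qed.

End arcsine_moment.

(** * Integrals under the 2-negative binomial law *)

Section negbin2_integral.
Variables (R : realType) (p : R).
Hypothesis p01 : 0 < p < 1.

Lemma ge0_integral_negbin2 (f : nat -> R) : (forall m, 0 <= f m) ->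
  (\int[negbin2 p]_m (f m)%:E = \sum_(m <oo) (f m * negbin2_pmf p m)%:E)%E.
Proof.
move=> f0.
have -> : [set: nat] = \bigcup_n [set n] by apply/seteqP; split => // n _;
  exists n.
rewrite ge0_integral_bigcup//=; last 2 first.
- by move=> m _; rewrite lee_fin.
- by move=> i j _ _ [m [/= <- <-]].
apply: eq_eseriesr => m _.
transitivity (\int[negbin2 p]_(x in [set m]) cst (f m)%:E x)%E.
  by apply: eq_integral => x; rewrite inE => ->.
rewrite integral_cst//= [negbin2 _ _]/negbin2 p01 esum_set1 ?EFinM//.
by rewrite lee_fin negbin2_pmf_ge0.
Qed.

(** The denominator m + 1 cancels the factor m + 1 of the mass function, leaving a geometric
    series. *)
Lemma integral_negbin2_harmonic (K : R) : 0 <= K ->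
  (\int[negbin2 p]_m (K / m.+1%:R)%:E = (K * (1 - p))%:E)%E.
Proof.
move=> K0; have /andP[p0 p1] := p01.
have q0 : 1 - p != 0 by rewrite subr_eq0 gt_eqF.
rewrite ge0_integral_negbin2//; last by move=> m; rewrite divr_ge0.
apply/cvg_lim => //; under eq_fun do rewrite sumEFin.
apply: cvg_EFin; first exact: nearW.
have -> : K * (1 - p) = K * (1 - p) ^+ 2 / (1 - p) by field.
rewrite (_ : _ \o _ = series (geometric (K * (1 - p) ^+ 2) p)).
  by apply: cvg_geometric_series; rewrite gtr0_norm.
apply/funext => n; apply: eq_bigr => m _ /=; rewrite /negbin2_pmf.
by field; rewrite addrC natr1 pnatr_eq0.
Qed.

Lemma integral_negbin2_bounds (f : nat -> R) (K L : R) : 0 <= K ->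
  (forall m, 0 <= f m) -> (forall m, L - K / m.+1%:R <= f m <= L) ->
  ((L - K * (1 - p))%:E <= \int[negbin2 p]_m (f m)%:E <= L%:E)%E.
Proof.
move=> K0 f0 fL.
have L0 : 0 <= L by rewrite (le_trans (f0 0%N))//; have /andP[] := fL 0%N.
have LE : (\int[negbin2 p]_m L%:E = L%:E)%E.
  by rewrite integral_cst//= probability_setT mule1.
apply/andP; split; last first.
  rewrite -[leRHS]LE; apply: ge0_le_integral => //.
  - by move=> m _; rewrite lee_fin.
  - by move=> m _; rewrite lee_fin; have /andP[] := fL m.
(* L - K / (m + 1) may be negative, so the K term is moved to the other side and only nonnegative
   functions are integrated. *)
rewrite EFinB leeBlDr// -integral_negbin2_harmonic//.
rewrite -[leLHS]LE -ge0_integralD//=; last 2 first.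
- by move=> m _; rewrite lee_fin.
- by move=> m _; rewrite lee_fin divr_ge0.
apply: ge0_le_integral => //.
by move=> m _; rewrite -EFinD lee_fin -lerBlDr; have /andP[] := fL m.
Qed.

End negbin2_integral.

(** * The limit, by squeezing *)

Theorem corollary10 (R : realType) (q : R) (hq0 : 0 < q) (hq1 : q < 1)
    (k : nat) :
  (\int[negbin2 (t * q)]_m
      (factorial_moment q k m.+1 * ((pochhammer m.+2%:R k)^-1)%:E))%E
    @[t --> within `]0, 1 / q[ (nbhs (1 / q))] -->
  (\int[lebesgue_measure]_(u in `[0%R, 1%R])
     \int[lebesgue_measure]_(s in `](-1)%R, 1%R[)
       (((u * (1 + q + 2 * Num.sqrt q * s) / (1 - q)) ^+ k
          / (pi * Num.sqrt (1 - s ^+ 2)))%R : R)%:E)%E.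
Proof.
set rhs := (X in _ --> X); pose L := limit_moment q k.
have q1 : 0 < 1 - q by rewrite subr_gt0.
(* The inner integral is the arcsine moment with c = u / (1 - q); the remaining integral of u^k
   supplies the factor 1 / (k + 1). *)
have -> : rhs = L%:E.
  rewrite /rhs; pose S := \sum_(j < k.+1) 'C(k, j)%:R ^+ 2 * q ^+ j.
  transitivity (\int[lebesgue_measure]_(u in `[0%R, 1%R])
      (u ^+ k * ((1 - q) ^- k * S))%:E)%E.
    apply: eq_integral => u; rewrite inE/= in_itv/= => /andP[u0 _].
    have -> : u ^+ k * ((1 - q) ^- k * S) = (u / (1 - q)) ^+ k * S.
      by rewrite mulrA exprMn exprVn.
    rewrite -integral_arcsine_moment ?(ltW hq0) ?divr_ge0 ?(ltW q1)//.
    by apply: eq_integral => s _; rewrite mulrAC.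
  by rewrite integral_exprn mulrAC.
pose f m := fine (factorial_moment q k m.+1) / pochhammer m.+2%:R k.
(* The closed form shows that the moment is finite, so [fine] loses nothing. *)
have fE m : (factorial_moment q k m.+1 * ((pochhammer m.+2%:R k)^-1)%:E = (f m)%:E)%E.
  by rewrite /f factorial_momentE.
under eq_fun do under eq_integral do rewrite fE.
have L0 : 0 <= L.
  rewrite mulr_ge0//; first by rewrite divr_ge0// invr_ge0 exprn_ge0// ltW.
  by apply: sumr_ge0 => j _; rewrite mulr_ge0// exprn_ge0// ltW.
have f0 m : 0 <= f m.
  rewrite /f factorial_momentE// divr_ge0//=.
    rewrite !mulr_ge0 ?invr_ge0 ?exprn_ge0 ?(ltW q1)//.
    by apply: sumr_ge0 => j _; rewrite !mulr_ge0// exprn_ge0// ltW.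
  by apply: prodr_ge0 => j _; rewrite addr_ge0.
pose K := L * (k * k.+1)%:R.
have K0 : 0 <= K by rewrite mulr_ge0.
apply: (@squeeze_cvge _ _ _ _ (fun t => (L - K * (1 - t * q))%:E) _ (fun=> L%:E)).
(* Restricting t to ]0, 1 / q[ gives 0 < t q < 1, where [negbin2] is the actual law and not its
   default value. *)
- near=> t; have : `]0, 1 / q[%classic t by near: t; exact: withinT.
  rewrite /= in_itv/= => /andP[t0 tq]; apply: integral_negbin2_bounds => //.
    by rewrite mulr_gt0//= -ltr_pdivlMr.
  by move=> m; exact: scaled_moment_bounds.
- apply: cvg_EFin; first exact: nearW.
  have : L - K * (1 - t * q) @[t --> 1 / q] --> L - K * (1 - 1 / q * q).
    apply: cvgB; first exact: cvg_cst.
    apply: cvgM; first exact: cvg_cst.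
    apply: cvgB; first exact: cvg_cst.
    by apply: cvgM; [exact: cvg_id|exact: cvg_cst].
  by rewrite divfK ?gt_eqF// subrr mulr0 subr0; exact: cvg_within_filter.
- exact: cvg_cst.
Unshelve. all: by end_near.
Qed.
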